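(* For an arbitrary initial $\{n/m\}$ star-polygon ($n\ge2$, $1\le m\le n/2$ natural numbers), with the points $O,A,O^1,L^l,M^l$ as defined in the context and for every integer $l$ with $0\le l\le n$, where $l=2i$ if $n$ is even and $l=2i+1$ if $n$ is odd ($i\ge0$, $i\in\mathbb{Z}$), $$\frac{OM^l}{OA}=\frac{1-P(n,m)-P(n,m)\cos(l\pi/n)}{\cos(\pi/n)},\qquad \angle O^1OM^l=\frac{\pi}{n},$$ and $$\frac{OL^l}{OA}=\sqrt{2P(n,m)\big(P(n,m)-1\big)\big(1+\cos(l\pi/n)\big)+1},$$ $$\gamma(n,m,l):=\angle O^1OL^l=\arctan\left(\frac{P(n,m)\sin(l\pi/n)}{1-P(n,m)-P(n,m)\cos(l\pi/n)}\right).$$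
   Context: Put $$P(n,m)=\frac{\sin(\pi/n)}{2\cos\big((m-1)\pi/n\big)\,\sin(m\pi/n)}.$$ The $\{n/m\}$ star-polygon has as vertices $n$ points dividing a circle with centre $O$ into $n$ equal arcs, each vertex being joined to the $m$-th next one. Let $A$ be one of its vertices. Scale the polygon by the factor $P(n,m)$ with respect to $A$; the scaled polygon has centre $O^1$ on the segment $OA$, with $O^1A/OA=P(n,m)$. For $l$ as in the claim, $L^l$ is the vertex of the scaled polygon, on a fixed side of (or on) the line $OA$, with $\angle OO^1L^l=l\pi/n$ (so $L^n=A$ and $O^1L^l=O^1A$). The point $M^l$ is the intersection of the line through $O$ that makes angle $\pi/n$ with the segment $O^1O$ (on the same side) and the line through $L^l$ perpendicular to $O^1O$. $OM^l$, $OL^l$, $OA$ denote lengths of segments.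
   Formalization: The angle claims for M and L are asserted only when M≠O and L≠O (both fail only for l=0 with m=1 or m=n/2, where the angles and the arctan's argument 0/0 are undefined); for n=2 the point M does not exist, so the claims about M are void there. *)

(* Defs.v *)
From Stdlib Require Import Reals Lra Lia.
From Coquelicot Require Import Coquelicot.

Open Scope R_scope.

(* The Euclidean plane is [C], with [Cmod] as Euclidean norm. *)

Definition len (X Y : C) : R := Cmod (Cminus Y X).

Definition dot (u v : C) : R := Re u * Re v + Im u * Im v.

Definition cross (u v : C) : R := Re u * Im v - Im u * Re v.

(* Unoriented angle XYZ, in [0, PI]; meaningful only if X <> Y and Z <> Y. *)
Definition angle (X Y Z : C) : R :=
  acos (dot (Cminus X Y) (Cminus Z Y) / (len Y X * len Y Z)).

Definition line (X Y : C) : C -> Prop :=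
  fun Z => exists t : R, Z = Cplus X (Cmult t (Cminus Y X)).

Definition perp_line (Z X Y : C) : C -> Prop :=
  fun W => dot (Cminus W Z) (Cminus Y X) = 0.

(* Two lines that are parallel or equal have no intersection point
   in this sense. *)
Definition is_intersection (d d' : C -> Prop) (M : C) : Prop :=
  forall Z, d Z /\ d' Z <-> Z = M.

Definition off_line (X Y B : C) : Prop :=
  cross (Cminus Y X) (Cminus B X) <> 0.

(* For B off the line XY: Z lies in the open (resp. closed) half-plane
   bounded by XY that contains B. *)
Definition on_side (X Y B Z : C) : Prop :=
  0 < cross (Cminus Y X) (Cminus B X) * cross (Cminus Y X) (Cminus Z X).

Definition on_side_or_line (X Y B Z : C) : Prop :=
  0 <= cross (Cminus Y X) (Cminus B X) * cross (Cminus Y X) (Cminus Z X).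

Record figure := Figure {
  vertex : C -> Prop;
  joined : C -> C -> Prop
}.

Definition circle_division (n : nat) (O : C) (r theta : R) (k : nat) : C :=
  let a := theta + 2 * PI * INR k / INR n in
  Cplus O (r * cos a, r * sin a).

(* [S] is an {n/m} star-polygon with centre [O]. *)
Definition is_star_polygon (n m : nat) (O : C) (S : figure) : Prop :=
  exists r theta : R,
    0 < r /\
    (forall X, vertex S X <->
       exists k, (k < n)%nat /\ X = circle_division n O r theta k) /\
    (forall X Y, joined S X Y <->
       exists k, (k < n)%nat /\
         let V := circle_division n O r theta k in
         let W := circle_division n O r theta (k + m) in
         (X = V /\ Y = W) \/ (X = W /\ Y = V)).

Definition homothety (A : C) (c : R) (X : C) : C :=
  Cplus A (Cmult c (Cminus X A)).

Definition scale (A : C) (c : R) (S : figure) : figure := {|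
  vertex := fun X => exists X0, vertex S X0 /\ X = homothety A c X0;
  joined := fun X Y => exists X0 Y0,
    joined S X0 Y0 /\ X = homothety A c X0 /\ Y = homothety A c Y0
|}.

Definition P (n m : nat) : R :=
  sin (PI / INR n) /
  (2 * cos ((INR m - 1) * PI / INR n) * sin (INR m * PI / INR n)).

(* Main.v *)
Require Import Defs.
From Stdlib Require Import Reals Lra Lia.
From Coquelicot Require Import Coquelicot.
Open Scope R_scope.

(** With a = A - O and w the vector from O to the vertex of the initial polygon
that is sent to L, we have |w| = |a| and L - O = (1 - P) a + P w, and the angle
at O^1 gives <a, w> = - |a|^2 cos (l PI / n); all the lengths and angles follow
from these inner products.  The signs are settled by 0 < P <= 1/2, which makes
1 - P - P cos (l PI / n) nonnegative and zero only when L = O. *)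

Ltac plane_coords :=
  repeat match goal with z : C |- _ => destruct z end;
  unfold homothety, dot, cross, Cminus, Cplus, Copp, Cmult, RtoC, Re, Im in *;
  simpl in *.

Lemma Cmod_dot (u : C) : Cmod u = sqrt (dot u u).
Proof. unfold Cmod, dot, Re, Im. f_equal. ring. Qed.

Lemma Cmod_sqr (u : C) : Cmod u * Cmod u = dot u u.
Proof.
rewrite Cmod_dot. apply sqrt_sqrt.
unfold dot. nra.
Qed.

(** Cauchy-Schwarz via Lagrange's identity: the squared product of the norms exceeds the squared
    [dot] by the square of [cross]. *)
Lemma dot_Cmod_le (u v : C) : Rabs (dot u v) <= Cmod u * Cmod v.
Proof.
rewrite <- (Rabs_pos_eq (Cmod u * Cmod v))
  by (apply Rmult_le_pos; apply Cmod_ge_0).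
apply Rsqr_le_abs_0. unfold Rsqr.
replace (Cmod u * Cmod v * (Cmod u * Cmod v))
  with ((Cmod u * Cmod u) * (Cmod v * Cmod v)) by ring.
rewrite !Cmod_sqr.
assert (E : dot u u * dot v v = dot u v * dot u v + cross u v * cross u v)
  by (plane_coords; ring).
rewrite E. nra.
Qed.

Lemma Cmod_zero_dot (u v : C) : Cmod u * Cmod v = 0 -> dot u v = 0.
Proof.
intros H. pose proof (dot_Cmod_le u v) as Hd. rewrite H in Hd.
apply Rabs_eq_0. pose proof (Rabs_pos (dot u v)). lra.
Qed.

Lemma len_pos (X Y : C) : Y <> X -> 0 < len X Y.
Proof.
intros H. apply Cmod_gt_0. intros E. apply H.
plane_coords. injection E as E1 E2. f_equal; lra.
Qed.

(** If a leg has length zero, both sides vanish whatever value [angle] takes there; otherwise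
    Cauchy-Schwarz puts the quotient in [-1, 1], where [cos] undoes [acos]. *)
Lemma dot_angle (X Y Z : C) :
  dot (Cminus X Y) (Cminus Z Y) = cos (angle X Y Z) * (len Y X * len Y Z).
Proof.
unfold angle, len.
set (u := Cminus X Y). set (v := Cminus Z Y).
destruct (Req_dec (Cmod u * Cmod v) 0) as [H0 | H0].
- rewrite H0, (Cmod_zero_dot u v H0). ring.
- pose proof (dot_Cmod_le u v) as Hd.
  assert (Hp : 0 < Cmod u * Cmod v).
  { pose proof (Rmult_le_pos _ _ (Cmod_ge_0 u) (Cmod_ge_0 v)). lra. }
  pose proof (Rle_abs (dot u v)). pose proof (Rle_abs (- dot u v)) as Hn.
  rewrite Rabs_Ropp in Hn.
  rewrite cos_acos.
  + field. split; intros E; apply H0; rewrite E; ring.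
  + split; apply (Rmult_le_reg_r (Cmod u * Cmod v)); try exact Hp;
      unfold Rdiv; rewrite Rmult_assoc, Rinv_l by exact H0; lra.
Qed.

Lemma angle_of_dot (X Y Z : C) (alpha : R) :
  X <> Y -> Z <> Y -> 0 <= alpha <= PI ->
  dot (Cminus X Y) (Cminus Z Y) = cos alpha * (len Y X * len Y Z) ->
  angle X Y Z = alpha.
Proof.
intros HX HZ Ha E. apply len_pos in HX. apply len_pos in HZ.
unfold angle. rewrite E.
replace (cos alpha * (len Y X * len Y Z) / (len Y X * len Y Z))
  with (cos alpha) by (field; lra).
now apply acos_cos.
Qed.

Lemma star_polygon_equidistant (n m : nat) (O : C) (S : figure) :
  is_star_polygon n m O S ->
  exists r, 0 < r /\ forall X, vertex S X -> len O X = r.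
Proof.
intros (r & theta & Hr & HV & _). exists r. split; [exact Hr |].
intros X HX. apply HV in HX. destruct HX as (k & _ & ->).
unfold len, circle_division. cbv zeta.
set (a := theta + 2 * PI * INR k / INR n).
rewrite Cmod_dot. transitivity (sqrt (r * r)); [f_equal | apply sqrt_square; lra].
pose proof (sin2_cos2 a) as E. unfold Rsqr in E.
plane_coords.
transitivity (r * r * (sin a * sin a + cos a * cos a)); [ring | rewrite E; ring].
Qed.

Lemma P_bounds (n m : nat) :
  (2 <= n)%nat -> (1 <= m)%nat -> INR m <= INR n / 2 -> 0 < P n m <= 1 / 2.
Proof.
intros Hn Hm Hmn. unfold P.
apply le_INR in Hn, Hm. simpl in Hn, Hm.
set (x := PI / INR n).
replace ((INR m - 1) * PI / INR n) with (INR m * x - x) by (unfold x; field; lra).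
replace (INR m * PI / INR n) with (INR m * x) by (unfold x; field; lra).
pose proof PI_RGT_0 as Hpi.
assert (Hx : INR n * x = PI) by (unfold x; field; lra).
assert (Hx0 : 0 < x) by (apply Rdiv_lt_0_compat; lra).
set (al := INR m * x).
assert (Hal : x <= al <= PI / 2).
{ unfold al. split; nra. }
assert (Hs : 0 < sin x) by (apply sin_gt_0; nra).
assert (H1 : 0 <= cos al) by (apply cos_ge_0; lra).
assert (H2 : 0 <= sin (al - x)) by (apply sin_ge_0; lra).
(* Write x as al - (al - x). Since x <= al <= PI / 2, the subtracted product is nonnegative, so
   [sin x] is at most half the denominator, which is therefore positive. *)
assert (E : sin x = sin al * cos (al - x) - cos al * sin (al - x)).
{ rewrite <- sin_minus. f_equal. ring. }
assert (HD : 2 * sin x <= 2 * cos (al - x) * sin al) by nra.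
split.
- apply Rdiv_lt_0_compat; lra.
- apply (Rmult_le_reg_r (2 * cos (al - x) * sin al)); [lra |].
  unfold Rdiv at 1. rewrite Rmult_assoc, Rinv_l; lra.
Qed.

(** Both sides are the angle at the leg x of a right triangle with legs x and y. This turns the
    [acos] inside [angle] into the arctangent of the claim. *)
Lemma acos_div_sqrt (x y : R) :
  0 < x -> 0 <= y -> acos (x / sqrt (x * x + y * y)) = atan (y / x).
Proof.
intros Hx Hy.
assert (Hq : 0 < x * x + y * y) by nra.
pose proof (sqrt_lt_R0 _ Hq) as Hs.
pose proof (sqrt_sqrt _ (Rlt_le _ _ Hq)) as Hss.
set (s := sqrt (x * x + y * y)) in *.
rewrite acos_atan by (apply Rdiv_lt_0_compat; lra).
f_equal.
replace (1 - (x / s)²) with ((y / s) * (y / s)).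
- rewrite sqrt_square.
  + field. split; lra.
  + apply Rmult_le_pos; [lra | left; now apply Rinv_0_lt_compat].
- unfold Rsqr. replace 1 with (s * s / (s * s)) by (field; lra).
  rewrite Hss at 1. field. lra.
Qed.

(** Here k is the signed length of the projection of OL onto the direction ON. M has the same
    projection, because LM is perpendicular to ON, so OM times [cos alpha] is k once M is known to
    lie on the ray from O through D. *)
Lemma perp_foot_on_ray (O N D L M : C) (alpha k : R) :
  0 <= alpha <= PI / 2 -> 0 <= k -> N <> O -> D <> O ->
  angle N O D = alpha ->
  dot (Cminus L O) (Cminus N O) = k * len O N ->
  is_intersection (line O D) (perp_line L N O) M ->
  len O M = k / cos alpha /\ (M <> O -> angle N O M = alpha).
Proof.
intros Ha Hk HN HD Hang HL HM.
pose proof (len_pos _ _ HN) as HlN. pose proof (len_pos _ _ HD) as HlD.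
pose proof (dot_angle N O D) as Hdot. rewrite Hang in Hdot.
destruct (proj2 (HM M) eq_refl) as [[t Ht] Hperp].
unfold perp_line in Hperp.
assert (Hc : 0 < cos alpha).
{ destruct (cos_ge_0 alpha) as [Hc | Hc]; [lra | lra | exact Hc |].
  rewrite <- Hc, Rmult_0_l in Hdot. exfalso.
  (* At a right angle the two lines are parallel, so M + (D - O) lies on both. *)
  assert (E : Cplus M (Cminus D O) = M).
  { apply HM. split.
    - exists (t + 1). rewrite Ht. clear. plane_coords. f_equal; ring.
    - unfold perp_line. clear - Hdot Hperp. plane_coords. lra. }
  apply HD. clear - E. plane_coords. injection E as E1 E2. f_equal; lra. }
assert (HMdot : dot (Cminus N O) (Cminus M O) = k * len O N).
{ rewrite <- HL. clear - Hperp. plane_coords. lra. }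
assert (HtD : dot (Cminus N O) (Cminus M O) = t * dot (Cminus N O) (Cminus D O)).
{ rewrite Ht. clear. plane_coords. ring. }
assert (Htk : t * len O D * cos alpha = k).
{ apply (Rmult_eq_reg_r (len O N)); [| lra].
  rewrite <- HMdot, HtD, Hdot. ring. }
(* The sign of k decides between the ray through D and the opposite one. *)
assert (Ht0 : 0 <= t).
{ destruct (Rle_lt_dec 0 t) as [H | H]; [exact H | exfalso].
  assert (0 < len O D * cos alpha) by (apply Rmult_lt_0_compat; lra).
  nra. }
assert (HlM : len O M = t * len O D).
{ unfold len. replace (Cminus M O) with (Cmult t (Cminus D O)).
  - rewrite Cmod_mult, Cmod_R, Rabs_pos_eq by exact Ht0. reflexivity.
  - rewrite Ht. clear. plane_coords. f_equal; ring. }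
split.
- rewrite HlM, <- Htk. field. lra.
- intros HMO. apply angle_of_dot; [exact HN | exact HMO | lra |].
  rewrite HMdot, <- Htk, HlM. ring.
Qed.

Theorem mainTheorem5
  (n m l : nat)
  (hn : (2 <= n)%nat) (hm : (1 <= m)%nat) (hmn : INR m <= INR n / 2)
  (hl : (l <= n)%nat)
  (heven : Nat.Even n -> exists i : nat, l = (2 * i)%nat)
  (hodd : Nat.Odd n -> exists i : nat, l = (2 * i + 1)%nat)
  (S : figure) (O A : C)
  (hS : is_star_polygon n m O S) (hA : vertex S A)
  (O1 : C) (hO1 : O1 = homothety A (P n m) O)
  (* B only serves to fix a side of the line OA *)
  (B : C) (hB : off_line O A B)
  (L : C) (hL : vertex (scale A (P n m) S) L)
  (hLside : on_side_or_line O A B L)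
  (hLangle : angle O O1 L = INR l * PI / INR n) :
  (forall D M : C,
     angle O1 O D = PI / INR n -> on_side O A B D ->
     is_intersection (line O D) (perp_line L O1 O) M ->
     len O M / len O A =
       (1 - P n m - P n m * cos (INR l * PI / INR n)) / cos (PI / INR n) /\
     (M <> O -> angle O1 O M = PI / INR n)) /\
  len O L / len O A =
    sqrt (2 * P n m * (P n m - 1) * (1 + cos (INR l * PI / INR n)) + 1) /\
  (L <> O ->
   angle O1 O L =
     atan (P n m * sin (INR l * PI / INR n) /
           (1 - P n m - P n m * cos (INR l * PI / INR n)))).
Proof.
pose proof (P_bounds n m hn hm hmn) as HP.
set (p := P n m) in *.
apply le_INR in hn, hl. simpl in hn.
pose proof PI_RGT_0 as Hpi.
assert (Hth : 0 <= INR l * PI / INR n <= PI).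
{ pose proof (pos_INR l). split.
  - apply Rmult_le_pos; [apply Rmult_le_pos; lra |].
    left; apply Rinv_0_lt_compat; lra.
  - apply (Rmult_le_reg_r (INR n)); [lra |].
    unfold Rdiv. rewrite Rmult_assoc, Rinv_l by lra. nra. }
assert (Hpn : 0 <= PI / INR n <= PI / 2).
{ split.
  - left; apply Rdiv_lt_0_compat; lra.
  - apply Rmult_le_compat_l; [lra |]. apply Rinv_le_contravar; lra. }
set (th := INR l * PI / INR n) in *.
destruct (star_polygon_equidistant _ _ _ _ hS) as (r & Hr & HrV).
pose proof (HrV A hA) as HrA.
destruct hL as (W & HW & HLW). apply HrV in HW.
(* The homothety sends O to O1 and W to L, hence multiplies the radius OW by p. *)
assert (HlO1L : len O1 L = p * r).
{ unfold len in *. rewrite <- HW, HLW, hO1.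
  rewrite <- (Rabs_pos_eq p) at 3 by lra. rewrite <- Cmod_R, <- Cmod_mult.
  f_equal. clear. plane_coords. f_equal; ring. }
assert (HlO1O : len O1 O = (1 - p) * r).
{ unfold len in *. rewrite <- HrA, hO1.
  rewrite <- (Rabs_pos_eq (1 - p)) by lra. rewrite <- Cmod_R, <- Cmod_mult.
  rewrite <- Cmod_opp.
  f_equal. clear. plane_coords. f_equal; ring. }
assert (HlOO1 : len O O1 = (1 - p) * r).
{ rewrite <- HlO1O. unfold len. rewrite <- Cmod_opp. f_equal.
  clear. plane_coords. f_equal; ring. }
assert (HO1 : O1 <> O).
{ intros E. assert (H : len O O1 = 0).
  { unfold len. rewrite E. replace (Cminus O O) with (RtoC 0); [apply Cmod_0 |].
    clear. plane_coords. f_equal; ring. }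
  rewrite HlOO1 in H. nra. }
pose proof (dot_angle O O1 L) as HdL.
rewrite hLangle, HlO1L, HlO1O in HdL.
pose proof (Cmod_sqr (Cminus O1 O)) as Hq1. fold (len O O1) in Hq1.
pose proof (Cmod_sqr (Cminus L O1)) as Hq2. fold (len O1 L) in Hq2.
pose proof (Cmod_sqr (Cminus L O)) as Hq3. fold (len O L) in Hq3.
rewrite HlOO1 in Hq1. rewrite HlO1L in Hq2.
pose proof (sin2_cos2 th) as Hsc. unfold Rsqr in Hsc.
pose proof (COS_bound th) as Hcb.
assert (Hs0 : 0 <= sin th) by (apply sin_ge_0; lra).
(* In units of r, K and p * sin th are the coordinates of L seen from O, along OO1 and across it. *)
set (K := 1 - p - p * cos th).
assert (HK : 0 <= K) by (unfold K; nra).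
assert (HdOL : dot (Cminus L O) (Cminus O1 O) = r * K * len O O1).
{ transitivity (dot (Cminus O1 O) (Cminus O1 O) - dot (Cminus O O1) (Cminus L O1)).
  - clear. plane_coords. ring.
  - rewrite <- Hq1, HdL, HlOO1. unfold K. ring. }
(* Law of cosines in the triangle O O1 L, rearranged into the sum of the squared coordinates. *)
assert (HqL : len O L * len O L = r * r * (K * K + p * sin th * (p * sin th))).
{ rewrite Hq3.
  transitivity (dot (Cminus O1 O) (Cminus O1 O) + dot (Cminus L O1) (Cminus L O1)
    - 2 * dot (Cminus O O1) (Cminus L O1)).
  - clear. plane_coords. ring.
  - rewrite <- Hq1, <- Hq2, HdL. unfold K.
    replace (p * sin th * (p * sin th)) with (p * p * (1 - cos th * cos th))
      by (rewrite <- Hsc; ring).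
    ring. }
set (Q := K * K + p * sin th * (p * sin th)) in *.
assert (HQ0 : 0 <= Q) by (unfold Q; nra).
assert (HlOL : len O L = r * sqrt Q).
{ rewrite <- (sqrt_square (len O L)) by apply Cmod_ge_0.
  rewrite HqL, sqrt_mult by nra. rewrite sqrt_square by lra. reflexivity. }
split; [| split].
- intros D M HD HDs HM.
  assert (HDO : D <> O).
  { intros E. subst D. unfold on_side in HDs. clear - HDs. plane_coords. nra. }
  destruct (perp_foot_on_ray O O1 D L M (PI / INR n) (r * K)) as [H1 H2]; auto.
  { nra. }
  split; [| exact H2].
  rewrite H1, HrA. unfold Rdiv. replace (r * K * / cos (PI * / INR n) * / r)
    with (K * / cos (PI * / INR n) * (r * / r)) by ring.
  rewrite Rinv_r by lra. ring.
- rewrite HlOL, HrA.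
  replace (2 * p * (p - 1) * (1 + cos th) + 1) with Q.
  + field. lra.
  + unfold Q, K.
    replace (p * sin th * (p * sin th)) with (p * p * (1 - cos th * cos th))
      by (rewrite <- Hsc; ring).
    ring.
- intros HLO. pose proof (len_pos _ _ HLO) as HlL.
  (* K = 0 means p * cos th = 1 - p >= p, which forces cos th = 1 and sin th = 0; then OL = 0,
     contrary to L <> O. *)
  assert (HKp : 0 < K).
  { destruct HK as [HK | HK]; [exact HK | exfalso].
    assert (Hc1 : cos th = 1) by (unfold K in HK; nra).
    assert (Hs1 : sin th = 0) by (rewrite Hc1 in Hsc; nra).
    unfold Q in HqL. rewrite <- HK, Hs1 in HqL. nra. }
  rewrite <- acos_div_sqrt; [| exact HKp | nra].
  fold Q. unfold angle. f_equal.
  replace (dot (Cminus O1 O) (Cminus L O)) with (r * K * len O O1)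
    by (rewrite <- HdOL; clear; plane_coords; ring).
  rewrite HlOL in *.
  assert (Hl1 : 0 < len O O1) by (now apply len_pos).
  field. repeat split; try lra. nra.
Qed.
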